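(* Let $G=(V,E)$ be a star graph with $n\ge 1$ edges, let $R\ge 1$ be an integer, and let $K=\lceil \sqrt[R]{n}\,\rceil$. Let $e\mapsto(\pi_1(e),\dots,\pi_R(e))$ be any injective map from $E$ to $\{0,\dots,K-1\}^R$. Let $U$ consist of all pairs $(r,k)$ with $1\le r\le R$, $0\le k\le K-1$, and all triples $(r,s,k)$ with $1\le r<s\le R$, $0\le k\le K-1$. Label each edge $e\in E$ by $$[e]=\{(r,\pi_r(e)) : 1\le r\le R\}\cup\{(r,s,(\pi_r(e)+\pi_s(e)) \bmod K) : 1\le r<s\le R\}\subseteq U,$$ and for $S\subseteq E$ let $[S]=\bigcup_{e\in S}[e]$. Let $S\subseteq E$ be the edge set of a shortest path in $G$ between two vertices. Then there are no false positives for $S$; that is, there is no edge $f\in E$ with $f\notin S$ and $[f]\subseteq[S]$.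
   Context: A star graph with $n$ edges is a tree consisting of one central vertex joined by an edge to each of $n$ other vertices (leaves), with no other edges. A labelling of the edges of a graph $G=(V,E)$ with universal set $U$ assigns to each edge $e\in E$ a subset $[e]\subseteq U$; for $S\subseteq E$ one puts $[S]=\bigcup_{e\in S}[e]$ (so $[\emptyset]=\emptyset$). A false positive for $S$ is an edge $f\in E$ such that $f\notin S$ but $[f]\subseteq[S]$. A shortest path from $u$ to $v$ is a path from $u$ to $v$ with the minimum possible number of edges; it is identified with its set of edges, and paths with $0$ edges are allowed. Here $x \bmod K$ denotes the representative in $\{0,\dots,K-1\}$. The labelling in the claim is called the star labelling. *)

(* Defs.v *)
From mathcomp Require Import all_boot all_order all_algebra all_field.

Set Implicit Arguments.
Unset Strict Implicit.
Unset Printing Implicit Defensive.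

Import GRing.Theory Num.Theory.

Record sgraph := SGraph {
  vertex :> finType;
  adj : rel vertex;
  adj_sym : symmetric adj;
  adj_irr : irreflexive adj }.

Definition edge_sets (G : sgraph) : {set {set G}} :=
  [set e | [exists x : G, exists y : G, adj x y && (e == [set x; y])]].

Definition edge (G : sgraph) := {e : {set G} | e \in edge_sets G}.

(* [set~ c] is the set of leaves: there are n of them, and n edges. *)
Definition is_star (G : sgraph) (n : nat) : Prop :=
  exists c : G, #|[set~ c]| = n /\
    forall x y : G, adj x y = (x != y) && ((x == c) || (y == c)).

(* The vertices of the path are u :: p, so that it has size p edges. *)
Definition is_path (G : sgraph) (u v : G) (p : seq G) : bool :=
  [&& path (@adj G) u p, last u p == v & uniq (u :: p)].

Definition is_shortest_path (G : sgraph) (u v : G) (p : seq G) : Prop :=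
  is_path u v p /\ forall q : seq G, is_path u v q -> size p <= size q.

Definition path_edges (G : sgraph) (u : G) (p : seq G) : {set edge G} :=
  [set e | val e \in pairmap (fun x y => [set x; y]) u p].

Definition shortest_path_edge_set (G : sgraph) (u v : G) (S : {set edge G}) :
    Prop :=
  exists p : seq G, is_shortest_path u v p /\ S = path_edges u p.

Definition label_union (E U : finType) (lab : E -> {set U}) (S : {set E}) :
    {set U} :=
  \bigcup_(e in S) lab e.

Definition false_positive (E U : finType) (lab : E -> {set U}) (S : {set E})
    (f : E) : bool :=
  (f \notin S) && (lab f \subset label_union lab S).

(* In algC, R.-root of a nonnegative real is its nonnegative real R-th root;
   the ceiling is thus a nonnegative integer and absz only casts it to nat. *)
Definition ceil_root (R n : nat) : nat :=
  `|Num.ceil (R.-root (n%:R : algC))%R|%N.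

(* Indices r range over {0, ..., R-1} rather than {1, ..., R}: inl (r, k) is
   the pair (r, k), and inr ((r, s), k) with r < s is the triple (r, s, k). *)
Definition index_pair (R : nat) := {rs : 'I_R * 'I_R | rs.1 < rs.2}.

Definition star_universe (R K : nat) : finType :=
  ('I_R * 'I_K + index_pair R * 'I_K)%type.

(* (i + j) mod K; the argument i : 'I_K witnesses 0 < K. *)
Definition add_mod (K : nat) (i j : 'I_K) : 'I_K :=
  Ordinal (ltn_pmod (i + j) (leq_ltn_trans (leq0n i) (ltn_ord i))).

Definition star_label (E : finType) (R K : nat) (pi : E -> {ffun 'I_R -> 'I_K})
    (e : E) : {set star_universe R K} :=
  [set inl (r, pi e r) | r : 'I_R] :|:
  [set inr (rs, add_mod (pi e (val rs).1) (pi e (val rs).2))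
     | rs : index_pair R].

(* Main.v *)
Require Import Defs.
From mathcomp Require Import all_boot all_order all_algebra all_field.

(** Two disjoint edges cannot both contain the centre of the star, so a path
has at most two edges.  Suppose [S] is contained in [{a, b}] and [f], distinct
from [a] and [b], is a false positive.  Each coordinate of [f] agrees with that
of [a] or of [b]; as [f] differs from both, some coordinate [r] agrees with [b]
only and some coordinate [s] with [a] only.  Then [pi_r f + pi_s f] is
[pi_r b + pi_s a] modulo [K], which is neither [pi_r a + pi_s a] nor
[pi_r b + pi_s b]: the label [(r, s, _)] of [f] is not covered. *)

Lemma add_modC (K : nat) : commutative (@add_mod K).
Proof. by move=> i j; apply: val_inj; rewrite /= addnC. Qed.

Lemma add_modI (K : nat) (i : 'I_K) : injective (add_mod i).
Proof.
(* Cancelling [i] leaves a congruence modulo [K] between numbers below [K], hence an equality. *)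
move=> j k /(congr1 val) /= /eqP; rewrite eqn_modDl !modn_small //.
by move/eqP/val_inj.
Qed.

Lemma add_mod_injl (K : nat) (i : 'I_K) : injective (@add_mod K ^~ i).
Proof. by move=> j k; rewrite /= !(add_modC _ _ i); apply: add_modI. Qed.

Lemma star_label_coord (E : finType) (R K : nat)
    (pi : E -> {ffun 'I_R -> 'I_K}) (S : {set E}) (f : E) (r : 'I_R) :
  star_label pi f \subset label_union (star_label pi) S ->
  exists2 e, e \in S & pi f r = pi e r.
Proof.
move=> cov; pose x : star_universe R K := inl (r, pi f r).
have /(subsetP cov)/bigcupP[e eS] : x \in star_label pi f.
  by rewrite inE; apply/orP; left; apply/imsetP; exists r.
by move=> /setUP[|] /imsetP[y _] // [<- eq_e]; exists e.
Qed.

Lemma star_label_sum (E : finType) (R K : nat)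
    (pi : E -> {ffun 'I_R -> 'I_K}) (S : {set E}) (f : E) (r s : 'I_R) :
  star_label pi f \subset label_union (star_label pi) S -> r != s ->
  exists2 e, e \in S & add_mod (pi f r) (pi f s) = add_mod (pi e r) (pi e s).
Proof.
(* Triples exist only for [r < s]; the claim is symmetric in [r] and [s] because [add_mod]
   commutes. *)
move=> cov; wlog lt_rs : r s / r < s => [IH neq_rs|_].
  have [lt_rs|lt_sr|/val_inj eq_rs] := ltngtP r s.
  - exact: IH.
  - have [||e eS eq_e] := IH s r; rewrite 1?eq_sym //.
    by exists e => //; rewrite add_modC eq_e add_modC.
  - by rewrite eq_rs eqxx in neq_rs.
pose rs : index_pair R := Sub (r, s) lt_rs.
pose x : star_universe R K := inr (rs, add_mod (pi f r) (pi f s)).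
have /(subsetP cov)/bigcupP[e eS] : x \in star_label pi f.
  rewrite inE; apply/orP; right.
  by apply/imsetP; exists rs.
by move=> /setUP[|] /imsetP[y _] // [<- eq_e]; exists e => //; apply: val_inj.
Qed.

Lemma star_label_inj2 (E : finType) (R K : nat)
    (pi : E -> {ffun 'I_R -> 'I_K}) (a b f : E) :
  injective pi ->
  star_label pi f \subset label_union (star_label pi) [set a; b] ->
  f \in [set a; b].
Proof.
move=> pi_inj cov; rewrite !inE; apply: contraT; rewrite negb_or.
(* By injectivity of [pi], edges that agree in every coordinate are equal. *)
have differ e : f != e -> exists r : 'I_R, pi f r != pi e r.
  move=> neq; apply/existsP; apply: contra_neqT neq; rewrite negb_exists.
  by move=> /forallP eq_pi; apply/pi_inj/ffunP => r; apply/eqP/negPn.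
case/andP => /differ[r fa_r] /differ[s fb_s].
have fb_r : pi f r = pi b r.
  have [e /set2P[->|->] // eq_r] := star_label_coord _ _ _ _ _ _ r cov.
  by rewrite eq_r eqxx in fa_r.
have fa_s : pi f s = pi a s.
  have [e /set2P[->|->] // eq_s] := star_label_coord _ _ _ _ _ _ s cov.
  by rewrite eq_s eqxx in fb_s.
have neq_rs : r != s by apply: contraNneq fb_s => <-; rewrite fb_r.
(* If [a] covers the sum, cancelling coordinate [s] contradicts [fa_r]; if [b] does, cancelling [r]
   contradicts [fb_s]. *)
have [e /set2P[->|->]] := star_label_sum _ _ _ _ _ _ _ _ cov neq_rs.
  by rewrite fa_s => /add_mod_injl eq_r; rewrite eq_r eqxx in fa_r.
by rewrite fb_r => /add_modI eq_s; rewrite eq_s eqxx in fb_s.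
Qed.

(** Reduces the count to the two-edge case; [a = b] is allowed, which takes in singletons. *)
Lemma card_le2_subset (E : finType) (S : {set E}) :
  #|S| <= 2 -> S = set0 \/ exists a b, S = [set a; b].
Proof.
have [->|[a aS]] := set_0Vmem S; first by left.
rewrite (cardsD1 a) aS ltnS => le1; right; exists a.
have [Sa0|[b bSa]] := set_0Vmem (S :\ a).
  by exists a; rewrite -(setD1K aS) Sa0 setU0 setUid.
exists b; rewrite -{1}(setD1K aS); congr (_ |: _).
by apply/esym/eqP; rewrite eqEcard sub1set bSa cards1.
Qed.

Lemma star_label_no_false_positive (E : finType) (R K : nat)
    (pi : E -> {ffun 'I_R -> 'I_K}) (S : {set E}) (f : E) :
  injective pi -> 0 < R -> #|S| <= 2 -> ~~ false_positive (star_label pi) S f.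
Proof.
move=> pi_inj R0 S2; apply/negP => /andP[fS cov].
have [S0|[a [b Sab]]] := card_le2_subset _ _ S2.
  (* As [0 < R], the label of [f] contains a pair with index [0], which an empty union cannot
     cover. *)
  by have [e] := star_label_coord _ _ _ _ _ _ (Ordinal R0) cov; rewrite S0 inE.
by move: fS; rewrite Sab (star_label_inj2 _ _ _ _ a b f pi_inj) // -Sab.
Qed.

Lemma card_path_edges (G : sgraph) (u : G) (p : seq G) :
  #|path_edges u p| <= size p.
Proof.
pose s := pairmap (fun x y : G => [set x; y]) u p.
rewrite -(size_pairmap (fun x y : G => [set x; y]) u p) -/s.
(* Edges are counted through their underlying vertex sets, all of which occur in [s]. *)
rewrite -(card_imset _ val_inj); apply: leq_trans (card_size s).
by apply/subset_leq_card/subsetP => _ /imsetP[e + ->]; rewrite inE.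
Qed.

Lemma star_path_size (G : sgraph) (n : nat) (u v : G) (p : seq G) :
  is_star G n -> is_path u v p -> size p <= 2.
Proof.
move=> [c [_ adjE]] /and3P[]; case: p => [|x [|y [|z p]]] //=.
rewrite !adjE !inE !negb_or => /and4P[/andP[_ ux] _ /andP[_ yz] _] _.
case/and3P => /and4P[_ uy uz _] /and3P[xy xz _] _.
(* The centre lies in both the first edge and the third; each of the four cases equates two vertices
   that [uniq] keeps apart. *)
by move: uy uz xy xz; case/orP: ux yz => /eqP-> /orP[]/eqP->; rewrite eqxx.
Qed.

Theorem proposition2 (n R : nat) (hn : 1 <= n) (hR : 1 <= R)
    (G : sgraph) (hG : is_star G n)
    (pi : edge G -> {ffun 'I_R -> 'I_(ceil_root R n)}) (hpi : injective pi)
    (S : {set edge G}) (u v : G) (hS : shortest_path_edge_set u v S) :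
  ~ exists f : edge G, false_positive (star_label pi) S f.
Proof.
case: hS => p [[path_p _] ->] [f]; apply/negP.
apply: star_label_no_false_positive => //.
exact: leq_trans (card_path_edges _ u p) (star_path_size _ _ _ _ _ hG path_p).
Qed.
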